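(* There exists a signed graph $(G,\sigma)$ such that $G$ contains none of $P_4$, $P_3+P_2$ and $P_2+P_2+P_2$ as an induced subgraph, but $(G,\sigma)$ is neither $(\psi,\omega)$-perfect nor $(\psi,\chi)$-perfect.
   Context: $P_m$ is the path on $m$ vertices and $+$ denotes disjoint union. A signed graph $(G,\sigma)$ is a finite simple graph $G$ with a signature $\sigma:E(G)\to\{-,+\}$; induced subgraphs inherit the signature. Switching a set $S\subseteq V(G)$ changes the sign of every edge with exactly one end in $S$; two signed graphs on the same underlying graph are equivalent if one is obtained from the other by switching some set of vertices. For $k\ge1$ let $M_k=\{-n,\dots,-1,+1,\dots,+n\}$ if $k=2n$, and $M_k=\{-n,\dots,-1,\pm0,+1,\dots,+n\}$ if $k=2n+1$, where $\pm0$ is a single colour with $-(\pm0)=\pm0$. A $k$-colouring $\phi:V(G)\to M_k$ is proper if $\phi(u)\ne\sigma(uv)\phi(v)$ for every edge $uv$ (where $\sigma(uv)\phi(v)=\phi(v)$ if $\sigma(uv)=+$ and $-\phi(v)$ otherwise); the chromatic number $\chi(G,\sigma)$ is the smallest $k$ admitting a proper $k$-colouring. Let $K_k^*$ be the signed multigraph with vertex set $\{i\ge 0: +i\in M_k\}$ (vertex $0$ standing for colour $\pm0$ when $k$ is odd), in which every two distinct vertices are joined by exactly one positive and one negative edge, and every vertex $i\neq0$ carries exactly one negative loop. Given a $k$-colouring $\phi$, the reduced signed graph $R(G,\sigma,\phi)$ is obtained by (1) switching every vertex with a negative colour $-i$ and recolouring it $+i$; (2) identifying, for each $i$, all vertices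 of colour $+i$ (resp. $\pm0$) into a single vertex $i$ (resp. $0$), edges inside a class becoming loops; (3) keeping at most one positive and at most one negative edge (or loop) between any two vertices (or at any vertex). The colouring $\phi$ is complete if $R(G,\sigma,\phi)$ is exactly $K_k^*$. The achromatic number $\psi(G,\sigma)$ is the largest $k\ge1$ such that some signed graph equivalent to $(G,\sigma)$ admits a complete $k$-colouring. The clique number $\omega(G,\sigma)$ is the clique number $\omega(G)$ of the underlying graph. For distinct $\alpha,\beta\in\{\omega,\chi,\psi\}$, $(G,\sigma)$ is $(\alpha,\beta)$-perfect if $\alpha(H,\sigma)=\beta(H,\sigma)$ for every induced subgraph $H$ of $G$. *)

(* Defs.v *)
From HB Require Import structures.
From mathcomp Require Import all_boot all_order all_algebra.
From mathcomp Require Import boolp.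

Set Implicit Arguments.
Unset Strict Implicit.
Unset Printing Implicit Defensive.

Import Order.TTheory GRing.Theory Num.Theory.

Record graph := Graph {
  vertex :> finType;
  adj : rel vertex;
  adj_sym : symmetric adj;
  adj_irr : irreflexive adj }.

Definition induced_in (H G : graph) : Prop :=
  exists f : H -> G, injective f /\ forall x y, adj (f x) (f y) = adj x y.

Section PathGraph.
Variable m : nat.
Definition path_adj : rel 'I_m := fun i j => (i.+1 == j) || (j.+1 == i).
Lemma path_adj_sym : symmetric path_adj.
Proof. by move=> i j; rewrite /path_adj orbC. Qed.
Lemma path_adj_irr : irreflexive path_adj.
Proof. by move=> i; rewrite /path_adj orbb gtn_eqF. Qed.
Definition path_graph : graph := Graph path_adj_sym path_adj_irr.
End PathGraph.

Section DisjointUnion.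
Variables G H : graph.
Definition union_adj : rel (G + H)%type := fun x y =>
  match x, y with
  | inl u, inl v => adj u v
  | inr u, inr v => adj u v
  | _, _ => false
  end.
Lemma union_adj_sym : symmetric union_adj.
Proof. by move=> [u|u] [v|v] //=; exact: adj_sym. Qed.
Lemma union_adj_irr : irreflexive union_adj.
Proof. by move=> [u|u] /=; exact: adj_irr. Qed.
Definition disjoint_union : graph := Graph union_adj_sym union_adj_irr.
End DisjointUnion.

(* [neg u v] means that the edge uv has sign -; the values of [neg] on
   non-adjacent pairs are irrelevant. *)
Record signed_graph := SignedGraph {
  underlying :> graph;
  neg : rel underlying;
  neg_sym : symmetric neg }.

Section Induced.
Variables (G : signed_graph) (A : {set G}).
Definition induced_adj : rel {x : G | x \in A} :=
  fun x y => adj (val x) (val y).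
Lemma induced_adj_sym : symmetric induced_adj.
Proof. by move=> x y; exact: adj_sym. Qed.
Lemma induced_adj_irr : irreflexive induced_adj.
Proof. by move=> x; exact: adj_irr. Qed.
Definition induced_graph : graph := Graph induced_adj_sym induced_adj_irr.
Definition induced_neg : rel induced_graph :=
  fun x y => neg (val x) (val y).
Lemma induced_neg_sym : symmetric induced_neg.
Proof. by move=> x y; exact: neg_sym. Qed.
Definition induced : signed_graph := SignedGraph induced_neg_sym.
End Induced.

Section Switch.
Variables (G : signed_graph) (S : {set G}).
Definition switch_neg : rel G :=
  fun u v => neg u v (+) ((u \in S) (+) (v \in S)).
Lemma switch_neg_sym : symmetric switch_neg.
Proof. by move=> u v; rewrite /switch_neg neg_sym (addbC (u \in S)). Qed.
Definition switch : signed_graph := SignedGraph switch_neg_sym.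
End Switch.

(* Colours are integers, the single colour ±0 being the integer 0. *)
Definition M (k : nat) : pred int :=
  [pred c : int | (absz c <= k./2) && (odd k || (c != 0%R))].

Definition colouring (G : signed_graph) (k : nat) (phi : G -> int) : Prop :=
  forall v, phi v \in M k.

Definition proper (G : signed_graph) (phi : G -> int) : Prop :=
  forall u v, adj u v -> phi u <> (if neg u v then - phi v else phi v)%R.

Definition colourable (G : signed_graph) (k : nat) : Prop :=
  exists phi : G -> int, colouring k phi /\ proper phi.

(* A signed multigraph on a set of naturals with at most one edge (or loop) of
   each sign between any two vertices: [medge b i j] holds when i and j are
   joined by an edge of sign - (b = true) or + (b = false). *)
Record multigraph := Multigraph {
  mvertex : nat -> Prop;
  medge : bool -> nat -> nat -> Prop }.

Definition same_multigraph (X Y : multigraph) : Prop :=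
  (forall i, mvertex X i <-> mvertex Y i) /\
  (forall b i j, medge X b i j <-> medge Y b i j).

Definition Kstar (k : nat) : multigraph := {|
  mvertex := fun i => i%:Z%R \in M k;
  medge := fun b i j => [/\ i%:Z%R \in M k, j%:Z%R \in M k &
                            i <> j \/ (i = j /\ i <> 0 /\ b = true)] |}.

Definition identify (G : signed_graph) (c : G -> nat) : multigraph := {|
  mvertex := fun i => exists v, c v = i;
  medge := fun b i j => exists u v, [/\ adj u v, neg u v = b, c u = i & c v = j] |}.

Definition reduced (G : signed_graph) (phi : G -> int) : multigraph :=
  @identify (switch [set v | (phi v < 0)%R]) (fun v => absz (phi v)).

Definition complete (G : signed_graph) (k : nat) (phi : G -> int) : Prop :=
  colouring k phi /\ same_multigraph (reduced phi) (Kstar k).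

Definition completely_colourable (G : signed_graph) (k : nat) : Prop :=
  0 < k /\ exists (S : {set G}) (phi : switch S -> int), complete k phi.

Definition clique (G : signed_graph) (A : {set G}) : bool :=
  [forall u in A, forall v in A, (u != v) ==> adj u v].

Definition omega (G : signed_graph) : nat :=
  \max_(A : {set G} | clique A) #|A|.

Lemma chi_subproof (G : signed_graph) :
  exists k, `[< 0 < k /\ colourable G k >].
Proof.
exists (#|G|.+1.*2); apply/asboolP; split; first by rewrite doubleS.
exists (fun v => (enum_rank v).+1%:Z%R); split=> [v|u v uv].
  by rewrite inE /= odd_double doubleK /= ltnW // ltnS ltn_ord.
case: ifP => _ // [] /ord_inj/enum_rank_inj E.
by move: uv; rewrite E adj_irr.
Qed.

Definition chi (G : signed_graph) : nat := ex_minn (chi_subproof G).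

(* The bound on k loses nothing: see [completely_colourable_bound]. *)
Definition psi (G : signed_graph) : nat :=
  \max_(k < (#|G|.*2).+2 | `[< completely_colourable G k >]) k.

Lemma completely_colourable_bound (G : signed_graph) (k : nat) :
  completely_colourable G k -> k < (#|G|.*2).+2.
Proof.
move=> [_ [S [phi [_ [Hv _]]]]].
have H (i : 'I_(k./2)) : exists v : G, absz (phi v) = i.+1.
  by apply/Hv; rewrite /= inE /= ltn_ord orbT.
have [f Hf] := choice H.
have inj_f : injective f.
  by move=> i j E; apply: ord_inj; apply: succn_inj; rewrite -!Hf E.
have := leq_card f inj_f; rewrite card_ord => le.
rewrite -[k]odd_double_half; case: (odd k); rewrite ?add1n ?add0n.
  by rewrite ltnS ltnS leq_double.
by rewrite ltnS leqW // leq_double.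
Qed.

Lemma psi_max (G : signed_graph) (k : nat) :
  completely_colourable G k -> k <= psi G.
Proof.
move=> Hk; have ltk := completely_colourable_bound Hk.
by apply: (bigop.bigmax_sup (Ordinal ltk)) => //; apply/asboolP.
Qed.

Lemma psi_attained (G : signed_graph) (k : nat) :
  completely_colourable G k -> completely_colourable G (psi G).
Proof.
move=> Hk; have ltk := completely_colourable_bound Hk.
have Pk : `[< completely_colourable G (Ordinal ltk) >] by apply/asboolP.
by rewrite /psi (bigop.bigmax_eq_arg _ Pk); case: arg_maxnP => // i /asboolP.
Qed.

(* Only nonempty induced subgraphs: the empty graph would have omega 0 and
   chi 1. *)
Definition perfect (alpha beta : signed_graph -> nat) (G : signed_graph) : Prop :=
  forall A : {set G}, A != set0 -> alpha (induced A) = beta (induced A).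

(* Main.v *)
(** The witness is the unbalanced 4-cycle, which has no induced [P_4] and too few
    vertices for the other two forbidden graphs.  Pair its vertices along two
    opposite negative edges: each class carries a negative loop, and the two
    remaining edges join the classes with opposite signs, so this is a complete
    4-colouring and [psi >= 4].  Giving one vertex the colour [±0] leaves a path,
    which is 2-colourable, so [chi <= 3]; and [omega <= 3] as two vertices are
    not adjacent. *)
Require Import Defs.
From mathcomp Require Import all_boot all_order all_algebra.
From mathcomp Require Import boolp.

Set Implicit Arguments.
Unset Strict Implicit.
Unset Printing Implicit Defensive.

Lemma induced_in_card (H G : graph) : induced_in H G -> #|H| <= #|G|.
Proof. by case=> f [/leq_card]. Qed.

Lemma chi_le (G : signed_graph) (k : nat) :
  0 < k -> colourable G k -> chi G <= k.
Proof.
move=> k_gt0 colG; rewrite /chi; case: ex_minnP => m _; apply.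
exact/asboolP.
Qed.

Lemma colourable_induced (G : signed_graph) (A : {set G}) (k : nat) :
  colourable G k -> colourable (induced A) k.
Proof.
case=> phi [colphi prophi]; exists (fun x => phi (val x)).
by split=> [v|u v]; [exact: colphi | exact: prophi].
Qed.

Lemma omega_lt_card (G : signed_graph) (u v : G) :
  u != v -> ~~ adj u v -> omega G < #|G|.
Proof.
move=> neq_uv nadj_uv.
have G_gt0 : 0 < #|G| by apply/card_gt0P; exists u.
rewrite -(prednK G_gt0) ltnS; apply/bigmax_leqP => A /forall_inP clA.
rewrite -ltnS prednK // ltn_neqAle max_card andbT.
(* A clique of full cardinality is the whole vertex set, so it contains both [u] and [v]. *)
apply: contra nadj_uv => /eqP cardA.
have inA x : x \in A.
  by rewrite (_ : A = setT) //; apply/eqP; rewrite eqEcard subsetT cardsT cardA /=.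
by have /forall_inP/(_ v (inA v))/implyP := clA u (inA u); apply.
Qed.

(* The vertices of the cycle are, in order, (0,0), (0,1), (1,1), (1,0). *)
Definition C4_adj : rel (bool * bool) :=
  fun x y => (x.1 (+) x.2) (+) (y.1 (+) y.2).

Lemma C4_adj_sym : symmetric C4_adj.
Proof. by move=> x y; rewrite /C4_adj addbC. Qed.

Lemma C4_adj_irr : irreflexive C4_adj.
Proof. by move=> x; rewrite /C4_adj addbb. Qed.

Definition C4 : graph := Graph C4_adj_sym C4_adj_irr.

(** The only positive edge joins (0,1) to (1,1); the three negative ones make the cycle
    unbalanced. *)
Definition C4_neg : rel C4 := fun x y => ~~ (x.2 && y.2).

Lemma C4_neg_sym : symmetric C4_neg.
Proof. by move=> x y; rewrite /C4_neg andbC. Qed.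

Definition unbalanced_C4 : signed_graph := SignedGraph C4_neg_sym.

(** Adjacency in [C4] means different parity of [x.1 (+) x.2]. Parity alternates along a path, so
    the two ends of an embedded [path_graph 4] would be adjacent. *)
Lemma C4_P4_free : ~ induced_in (path_graph 4) C4.
Proof.
case=> f [_ adjf].
have := adjf (@Ordinal 4 0 isT) (@Ordinal 4 1 isT).
have := adjf (@Ordinal 4 1 isT) (@Ordinal 4 2 isT).
have := adjf (@Ordinal 4 2 isT) (@Ordinal 4 3 isT).
have := adjf (@Ordinal 4 0 isT) (@Ordinal 4 3 isT).
rewrite /= /C4_adj /path_adj /=.
by do 4!case: ((f _).1 (+) (f _).2).
Qed.

Lemma colourable_unbalanced_C4 : colourable unbalanced_C4 3.
Proof.
(* The colour -1 may repeat on (1,0) and (1,1) because their edge is negative. *)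
exists (fun x : bool * bool =>
  (if x.1 then -1 else if x.2 then 1 else 0)%R : int).
by split=> [[[] []]|[[] []] [[] []]].
Qed.

Lemma completely_colourable_unbalanced_C4 :
  completely_colourable (induced [set: unbalanced_C4]) 4.
Proof.
pose V (x : bool * bool) : induced [set: unbalanced_C4] := Sub x (in_setT x).
pose phi (x : induced [set: unbalanced_C4]) : int :=
  if (val x : bool * bool).1 then 2%Z else 1%Z.
split=> //; exists set0, phi.
split=> [[[[] b] ?] //|]; split=> [i|b i j] /=.
  split=> [[[[[] b] ?] /= <-] //|].
  case: i => [|[|[|i]]] //= _.
    by exists (V (false, false)).
  by exists (V (true, false)).
(* Both switchings are trivial: the chosen set is empty, and [phi] takes no negative value. *)
have signE x y : switch_neg (G := switch set0)
    [set v | (phi v < 0)%R] x y = C4_neg (val x) (val y).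
  have phi_ge0 z : (phi z < 0)%R = false by rewrite /phi; case: ifP.
  by rewrite /switch_neg /= /switch_neg !inE !phi_ge0 !addbF.
split.
  move=> [[[x1 x2] xP] [[[y1 y2] yP] [+ + <- <-]]]; rewrite signE /=.
  rewrite /induced_adj /C4_adj /C4_neg /phi /=.
  case: x1 x2 y1 y2 b {xP yP} => [] [] [] [] [] //= _ _; split=> //;
    by [left | right].
case; case: i => [|[|[|i]]] //= _; case: j => [|[|[|j]]] //= _;
  case: b => -[] //=; try by case=> // _ [].
(* With ordered ends, [Kstar 4] has six edges: a negative loop at 1 and at 2, and both signs between
   1 and 2 in either direction. *)
- by exists (V (false, false)), (V (false, true)); rewrite signE.
- by exists (V (false, false)), (V (true, false)); rewrite signE.
- by exists (V (false, true)), (V (true, true)); rewrite signE.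
- by exists (V (true, false)), (V (false, false)); rewrite signE.
- by exists (V (true, true)), (V (false, true)); rewrite signE.
- by exists (V (true, false)), (V (true, true)); rewrite signE.
Qed.

Theorem theorem5p6 :
  exists G : signed_graph,
    [/\ ~ induced_in (path_graph 4) G,
        ~ induced_in (disjoint_union (path_graph 3) (path_graph 2)) G,
        ~ induced_in (disjoint_union (disjoint_union (path_graph 2)
                                                     (path_graph 2))
                                     (path_graph 2)) G,
        ~ perfect psi omega G
      & ~ perfect psi chi G].
Proof.
have psi_ge4 := psi_max completely_colourable_unbalanced_C4.
(* Both kinds of perfection already fail at the whole vertex set. *)
have nonempty : [set: unbalanced_C4] != set0.
  by apply/set0Pn; exists (false, false); rewrite inE.
exists unbalanced_C4; split.
- exact: C4_P4_free.
- by move/induced_in_card; rewrite card_sum !card_ord card_prod card_bool.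
- by move/induced_in_card; rewrite !card_sum !card_ord card_prod card_bool.
- move=> /(_ _ nonempty) psiE; move: psi_ge4; rewrite psiE leqNgt => /negP; apply.
  pose V (x : bool * bool) : induced [set: unbalanced_C4] := Sub x (in_setT x).
  have := @omega_lt_card _ (V (false, false)) (V (true, true)) isT isT.
  by rewrite /= card_sig (eq_card (in_setT (T := _))) card_prod card_bool.
- move=> /(_ _ nonempty) psiE; move: psi_ge4; rewrite psiE leqNgt => /negP; apply.
  exact/chi_le/colourable_induced/colourable_unbalanced_C4.
Qed.
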